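(* The category $\mathbf{Set}_{\leq\aleph_1}$ is algebraically cocomplete if and only if the continuum hypothesis ($2^{\aleph_0}=\aleph_1$) holds.
   Context: $\mathbf{Set}_{\leq\aleph_1}$ is the category of all sets of cardinality at most $\aleph_1$ and all mappings between them. A category is algebraically cocomplete if every endofunctor $F$ of it has a terminal coalgebra (a terminal object of the category of coalgebras $A\to FA$). *)

(* Defs.v *)
From mathcomp Require Import all_boot.
From mathcomp Require Import boolp classical_sets functions cardinality wochoice.

Set Implicit Arguments.
Unset Strict Implicit.
Unset Printing Implicit Defensive.

Local Open Scope classical_set_scope.
Local Open Scope card_scope.

Record category := Category {
  obj :> Type;
  hom : obj -> obj -> Type;
  idc : forall A, hom A A;
  compc : forall A B C, hom B C -> hom A B -> hom A C;
  compc1 : forall A B (f : hom A B), compc f (idc A) = f;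
  comp1c : forall A B (f : hom A B), compc (idc B) f = f;
  compcA : forall A B C D (h : hom C D) (g : hom B C) (f : hom A B),
    compc h (compc g f) = compc (compc h g) f }.

Arguments idc {c} A.
Arguments compc {c A B C}.

Record endofunctor (C : category) := Endofunctor {
  fobj :> C -> C;
  fmap : forall A B, hom A B -> hom (fobj A) (fobj B);
  fmap1 : forall A, fmap (idc A) = idc (fobj A);
  fmapM : forall A B D (g : hom B D) (f : hom A B),
    fmap (compc g f) = compc (fmap g) (fmap f) }.

Arguments fmap {C} e {A B}.

Definition terminal_object (C : category) (T : C) :=
  forall A : C, exists h : hom A T, forall k : hom A T, k = h.

Section Coalgebras.
Variables (C : category) (F : endofunctor C).

Record coalgebra := Coalgebra {
  carrier : C;
  structure : hom carrier (F carrier) }.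

Definition coalg_hom (A B : coalgebra) :=
  {h : hom (carrier A) (carrier B) |
    compc (structure B) h = compc (fmap F h) (structure A)}.

Lemma coalg_hom_inj (A B : coalgebra) (h k : coalg_hom A B) :
  sval h = sval k -> h = k.
Proof.
by case: h k => [h hP] [k kP] /= hk; subst k; rewrite (Prop_irrelevance hP kP).
Qed.

Fact coalg_id_proof (A : coalgebra) :
  compc (structure A) (idc (carrier A)) =
  compc (fmap F (idc (carrier A))) (structure A).
Proof. by rewrite fmap1 compc1 comp1c. Qed.

Definition coalg_id (A : coalgebra) : coalg_hom A A :=
  exist _ (idc (carrier A)) (coalg_id_proof A).

Fact coalg_comp_proof (A B D : coalgebra)
    (g : coalg_hom B D) (f : coalg_hom A B) :
  compc (structure D) (compc (sval g) (sval f)) =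
  compc (fmap F (compc (sval g) (sval f))) (structure A).
Proof.
by rewrite fmapM compcA (svalP g) -compcA (svalP f) compcA.
Qed.

Definition coalg_comp (A B D : coalgebra)
    (g : coalg_hom B D) (f : coalg_hom A B) : coalg_hom A D :=
  exist _ (compc (sval g) (sval f)) (coalg_comp_proof g f).

Fact coalg_compc1 (A B : coalgebra) (f : coalg_hom A B) :
  coalg_comp f (coalg_id A) = f.
Proof. by apply: coalg_hom_inj; rewrite /= compc1. Qed.

Fact coalg_comp1c (A B : coalgebra) (f : coalg_hom A B) :
  coalg_comp (coalg_id B) f = f.
Proof. by apply: coalg_hom_inj; rewrite /= comp1c. Qed.

Fact coalg_compcA (A B D E : coalgebra)
    (h : coalg_hom D E) (g : coalg_hom B D) (f : coalg_hom A B) :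
  coalg_comp h (coalg_comp g f) = coalg_comp (coalg_comp h g) f.
Proof. by apply: coalg_hom_inj; rewrite /= compcA. Qed.

Definition coalg_category : category :=
  Category coalg_compc1 coalg_comp1c coalg_compcA.

End Coalgebras.

Definition algebraically_cocomplete (C : category) :=
  forall F : endofunctor C,
    exists T : coalg_category F, terminal_object T.

(* wo_chain demands unique minima of nonempty subsets of wo_dom, hence makes
   wo_le a (reflexive) well-order there; values outside wo_dom are junk. *)
Record wo_nat := WoNat {
  wo_dom : {pred nat};
  wo_le : rel nat;
  wo_natP : wo_chain wo_le wo_dom }.

Definition wo_iso (v w : wo_nat) :=
  exists f : nat -> nat, set_bij [set` wo_dom v] [set` wo_dom w] f /\
    {in wo_dom v &, forall x y, wo_le v x y = wo_le w (f x) (f y)}.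

(* The set of countable ordinals, as isomorphism classes of well-ordered
   subsets of nat (Hartogs' construction); its cardinality is aleph_1. *)
Definition omega1 : set (set wo_nat) :=
  [set [set w | wo_iso v w] | v in [set: wo_nat]].

Record set_le_aleph1 := SetLeAleph1 {
  underlying :> Type;
  underlying_le : [set: underlying] #<= omega1 }.

Definition Set_le_aleph1 : category :=
  @Category set_le_aleph1 (fun A B => A -> B) (fun _ => id)
    (fun _ _ _ g f => g \o f)
    (fun _ _ _ => erefl) (fun _ _ _ => erefl) (fun _ _ _ _ _ _ _ => erefl).

Definition continuum_hypothesis : Prop := [set: nat -> bool] #= omega1.

(* Main.v *)
(* Necessity: on Set_<=aleph_1 the functor X * bool has coalgebras on nat whose
   behaviours at 0 are all binary streams; a terminal coalgebra would separate
   them, so 2^aleph_0 <= aleph_1.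

   Sufficiency: the continuum hypothesis provides a relation on the continuum
   Omega whose sections are countable on one side and co-countable on the
   other.  Diagonalizing along it against |F(Omega * Omega)| many functions
   gives a function Omega -> Omega that agrees only countably often with each
   of them, and from this every element of F X lies in the image of F s for
   some s : nat -> X.  Hence each element of a coalgebra lies in the image of a
   homomorphism from a coalgebra carried by seq nat.  There are at most
   aleph_1 ^ aleph_0 = aleph_1 such coalgebras, and identifying two elements of
   their sum when they have a common image in some coalgebra yields the
   terminal one. *)
Require Import Defs.
From mathcomp Require Import all_boot.
From mathcomp Require Import boolp classical_sets functions cardinality wochoice.

Set Implicit Arguments.
Unset Strict Implicit.
Unset Printing Implicit Defensive.

Local Open Scope classical_set_scope.
Local Open Scope card_scope.

(** * Well-orders and their initial segments *)

(** Well-founded recursion in which the value at [x] is chosen from the set of earlier values. The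
    choice is fixed beforehand for every set [A], with a junk value where [P A] has no solution. *)
Lemma wf_choice (V U : Type) (u0 : U) (lt : V -> V -> Prop)
    (P : set U -> U -> Prop) :
    well_founded lt -> (forall A, exists u, P A u \/ forall w, ~ P A w) ->
  exists f : V -> U, forall x, (exists u, P (f @` lt^~ x) u) ->
    P (f @` lt^~ x) (f x).
Proof.
move=> lt_wf /choice[c cP].
pose step x (rec : forall y, lt y x -> U) :=
  c [set u | exists y, exists h : lt y x, rec y h = u].
pose f := Fix lt_wf (fun=> U) step.
exists f => x [u Pu].
have -> : f x = c (f @` lt^~ x).
  rewrite /f Fix_eq => [|y g h gh]; last first.
    by congr (step y _); apply/functional_extensionality_dep => z; apply/funext.
  rewrite /step; congr c; apply/seteqP.
  by split=> w /= [y]; [move=> [h <-]; exists y | move=> h <-; exists y, h].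
by have [//|/(_ _ Pu)] := cP (f @` lt^~ x).
Qed.

Lemma countable_uncountableP (T : Type) (A : set T) :
  ~ countable [set: T] -> countable A -> exists x, ~ A x.
Proof.
move=> Tunc Ac; apply: contrapT => nA; apply: Tunc.
suff <- : A = [set: T] by [].
by apply/seteqP; split=> // x _; apply: contrapT => Ax; apply: nA; exists x.
Qed.

Definition before (T : Type) (R : rel T) (u : T) : {pred T} :=
  [pred x | ~~ R u x].

Section WellOrder.
Variables (T : eqType) (R : rel T).
Hypothesis Rwo : well_order R.

Lemma well_order_min (P : set T) x : P x ->
  exists2 m, P m & forall y, P y -> R m y.
Proof.
move=> Px; have [|m [[Pm lbm] _]] := Rwo (A := [pred y | `[< P y >]]).
  by exists x; apply/asboolP.
exists m; first exact/asboolP.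
by move=> y Py; apply: lbm; apply/asboolP.
Qed.

Lemma well_order_total x y : R x y || R y x.
Proof.
by have [m [->|->] lbm] := @well_order_min [set x; y] x (or_introl erefl);
  rewrite lbm ?orbT//; [right | left].
Qed.

Lemma well_order_anti x y : R x y -> R y x -> x = y.
Proof.
have /wo_chain_antisymmetric Ranti : wo_chain R (pred_of_simpl (@predT T)).
  by move=> A _; apply: Rwo.
by move=> Rxy Ryx; apply: Ranti => //; rewrite Rxy.
Qed.

Lemma well_order_trans y x z : R x y -> R y z -> R x z.
Proof.
move=> Rxy Ryz.
have [m + lbm] := @well_order_min [set w | w \in [:: x; y; z]] x (mem_head _ _).
rewrite /= !inE => /or3P[]/eqP mE; rewrite {m}mE in lbm.
- by apply: lbm; rewrite /= !inE eqxx !orbT.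
- rewrite (well_order_anti Rxy) //; apply: lbm; exact: mem_head.
- rewrite -(well_order_anti Ryz) //.
  by apply: lbm; rewrite /= !inE eqxx orbT.
Qed.

Lemma before_le u x : x \in before R u -> R x u.
Proof.
by rewrite inE => Rux; have := well_order_total x u; rewrite (negPf Rux) orbF.
Qed.

Lemma le_before_trans y x z : R x y -> y \in before R z -> x \in before R z.
Proof. by rewrite !inE => Rxy; apply: contra => /well_order_trans; apply. Qed.

Lemma before_le_trans y x z : x \in before R y -> R y z -> x \in before R z.
Proof. by rewrite !inE => + Ryz; apply: contra; apply: well_order_trans. Qed.

Lemma before_wf : well_founded (fun x y => x \in before R y).
Proof.
move=> x; apply: contrapT => nx.
have [m nm lbm] :=
  @well_order_min [set x | ~ Acc (fun x y => x \in before R y) x] x nx.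
apply: nm; split=> y ym; apply: contrapT => /lbm Rmy.
by move: ym; rewrite inE Rmy.
Qed.

End WellOrder.

(** [wo_iso] is by conversion the case of two orders on [nat], so the lemmas on [order_iso] apply to
    it. *)
Definition order_iso (T U : Type) (A : {pred T}) (R : rel T)
    (B : {pred U}) (S : rel U) :=
  exists f : T -> U, set_bij [set` A] [set` B] f /\
    {in A &, forall x y, R x y = S (f x) (f y)}.

Lemma order_iso_sym (T U : Type) (A : {pred T}) (R : rel T)
    (B : {pred U}) (S : rel U) (x0 : T) :
  order_iso A R B S -> order_iso B S A R.
Proof.
move=> [f [[fAB finj fsurj] fR]].
have /choice[g gP] : forall y, exists x, y \in B -> x \in A /\ f x = y.
  move=> y; have [/fsurj[x xA <-]|] := boolP (y \in B); first by exists x.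
  by exists x0.
exists g; split; last by move=> y z /gP[yA {1}<-] /gP[zA {1}<-]; rewrite -fR.
split=> [y /gP[]//|y z|x xA].
  by rewrite !inE => /gP[_ fy] /gP[_ fz] gyz; rewrite -fy -fz gyz.
have /gP[gA fgx] := fAB x xA; exists (f x); first exact: fAB.
by apply: finj => //; rewrite inE.
Qed.

Lemma order_iso_trans (T U V : Type) (A : {pred T}) (R : rel T)
    (B : {pred U}) (S : rel U) (C : {pred V}) (Q : rel V) :
  order_iso A R B S -> order_iso B S C Q -> order_iso A R C Q.
Proof.
move=> [f [fbij fR]] [g [gbij gS]]; exists (g \o f); split.
  exact: set_bij_comp fbij gbij.
have [fAB _ _] := fbij.
by move=> x y xA yA /=; rewrite fR // gS //; apply: fAB.
Qed.

Lemma wo_iso_class (v w : wo_nat) :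
  wo_iso v w -> [set z | wo_iso v z] = [set z | wo_iso w z].
Proof.
move=> vw; apply/seteqP; split=> z /=; last exact: order_iso_trans vw.
by apply: order_iso_trans; apply: order_iso_sym vw; exact: 0.
Qed.

(* The embedding is built by transfinite recursion, which never gets stuck
   because the target is uncountable. *)
Lemma wo_nat_segment (T : eqType) (R : rel T) (v : wo_nat) :
    well_order R -> ~ countable [set: T] ->
  exists u, order_iso (wo_dom v) (wo_le v) (before R u) R.
Proof.
move=> Rwo Tunc.
pose V : eqType := {n : nat | n \in wo_dom v}.
pose S : rel V := fun x y => wo_le v (val x) (val y).
have Swo : well_order S.
  move=> A [x0 x0A].
  have [| |m [[/= /asboolP[mv mA] lbm] um]] :=
      @wo_natP v (fun n => `[< exists h : n \in wo_dom v, A (Sub n h) >]).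
  - by move=> n /asboolP[].
  - exists (val x0); apply/asboolP; exists (valP x0).
    by rewrite (_ : Sub _ _ = x0) //; apply: val_inj.
  have valA (x : V) : x \in A ->
      val x \in (fun n => `[< exists h : n \in wo_dom v, A (Sub n h) >]).
    move=> xA; apply/asboolP; exists (valP x).
    by rewrite (_ : Sub _ _ = x) //; apply: val_inj.
  exists (Sub m mv); split; first by split=> // x /valA /lbm.
  move=> y [yA lby]; apply: val_inj => /=; apply: um; split; first exact: valA.
  by move=> n /asboolP[nv /lby].
have [u0 _] := countable_uncountableP Tunc (countable0 T).
(* [P A u] makes [u] the least element outside [A], so [f x] becomes the least value not taken
   before [x]. *)
pose P A u := ~ A u /\ forall w, ~ A w -> R u w.
have [|f fP] := wf_choice u0 (P := P) (before_wf Swo).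
  move=> A; have [[w wA]|nA] := pselect (exists w, ~ A w).
    by have [m] := well_order_min Rwo (P := ~` A) wA; exists m; left.
  by exists u0; right=> w [wA _]; apply: nA; exists w.
have imf_countable (A : set V) : countable (f @` A).
  apply: sub_countable (card_image_le _ _) _; exact: countableP.
have {}fP x : ~ (f @` [set y | y \in before S x]) (f x) /\
    forall w, ~ (f @` [set y | y \in before S x]) w -> R (f x) w.
  apply: fP.
  have [w wA] := countable_uncountableP Tunc
    (imf_countable [set y | y \in before S x]).
  by have [m] := well_order_min Rwo (P := ~` _) wA; exists m.
have f_le x y : S x y -> R (f x) (f y).
  move=> Sxy; apply: (fP x).2 => -[z zx zy]; apply: (fP y).1.
  by exists z => //; apply: before_le_trans Sxy.
have f_lt x y : x \in before S y -> f x != f y.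
  by move=> xy; apply/eqP => fxy; apply: (fP y).1; exists x.
have f_inj : injective f.
  move=> x y /eqP fxy; apply: (well_order_anti Swo); apply: contraLR fxy => /f_lt //.
  by rewrite eq_sym.
have fS x y : S x y = R (f x) (f y).
  apply/idP/idP => [/f_le//|fxy]; rewrite -[S x y]negbK; apply/negP => nxy.
  move: (f_lt y x nxy) => /eqP; apply.
  by apply: (well_order_anti Rwo) => //; apply/f_le/(before_le Swo).
have fdown x w : w \in before R (f x) -> range f w.
  rewrite inE => nw; apply: contrapT => wf.
  move: nw; rewrite (fP x).2 // => -[y _ fy]; apply: wf; by exists y.
have [w wf] := countable_uncountableP Tunc (imf_countable setT).
(* By [fdown] the range of [f] is downward closed, hence it is exactly the segment before its least
   missed element. *)
have [u nfu lbu] := well_order_min Rwo (P := ~` range f) wf.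
exists u.
exists (fun n => oapp f u0 (insub n)).
have fE (n : nat) : n \in wo_dom v -> exists2 x : V, val x = n &
    oapp f u0 (insub n : option V) = f x.
  by move=> nv; exists (Sub n nv) => //; rewrite insubT.
split; last first.
  by move=> n m /fE[x <- /= ->] /fE[y <- /= ->]; apply: fS.
split=> [n /fE[x _ /= ->]|n m|z zu].
- rewrite /= inE; apply/negP => ufx.
  have [ufx'|ufx'] := pselect (u = f x); first by apply: nfu; exists x.
  apply: nfu; apply: (fdown x); rewrite inE; apply/negP => fxu.
  exact/ufx'/(well_order_anti Rwo).
- by rewrite !inE => /fE[x <- /= ->] /fE[y <- /= ->] /f_inj ->.
- apply: contrapT => nz; move: zu; rewrite /= inE lbu //.
  by move=> [x _ fx]; apply: nz; exists (val x); [exact: valP | rewrite valK].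
Qed.

(** * The cardinality of omega1 *)

Lemma card_le_inj (T U : Type) (A : set T) (B : set U) (f : T -> U) :
  set_fun A B f -> set_inj A f -> A #<= B.
Proof.
move=> fAB finj.
have [g] := injfunPex.2 (ex_intro2 _ _ f fAB finj); exact: inj_card_le.
Qed.

Lemma card_le_injfun (T U : Type) (u0 : U) (A : set T) (B : set U) :
  A #<= B -> exists2 f : T -> U, set_fun A B f & set_inj A f.
Proof.
elim/Ppointed: U => U in u0 B *; first by have := no u0.
by move=> /pcard_leP/injfunPex.
Qed.

Lemma countable_setU (T : Type) (A B : set T) :
  countable A -> countable B -> countable (A `|` B).
Proof.
move=> Ac Bc; have -> : A `|` B = \bigcup_(b in [set: bool]) (if b then A else B).
  apply/seteqP; split=> [x [xA|xB]|x [[] _ xAB]];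
    [by exists true | by exists false | by left | by right].
by apply: bigcup_countable => // -[].
Qed.

(** In an uncountable well-order these points form the initial segment of type the first uncountable
    ordinal, a concrete copy of [omega1]. *)
Definition countable_before (T : Type) (R : rel T) : set T :=
  [set u | countable [set` before R u]].

Lemma omega1_le_countable_before (T : eqType) (R : rel T) :
  well_order R -> ~ countable [set: T] -> omega1 #<= countable_before R.
Proof.
move=> Rwo Tunc.
have /choice[f fP] : forall C : set wo_nat, exists u, omega1 C ->
    exists2 v, C = [set w | wo_iso v w] &
      order_iso (wo_dom v) (wo_le v) (before R u) R.
  move=> C; have [[v _ <-]|nC] := pselect (omega1 C).
    by have [u uP] := wo_nat_segment v Rwo Tunc; exists u => _; exists v.
  have [u _] := countable_uncountableP Tunc (countable0 T).
  by exists u => /nC.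
apply: (@card_le_inj _ _ _ _ f) => [C /fP[v _ [g [gbij _]]]|C D].
  rewrite /countable_before /=; have [_ _ gsurj] := gbij.
  apply: sub_countable (countableP [set` wo_dom v]).
  apply: card_le_trans (card_image_le g _); exact: subset_card_le.
rewrite !inE => /fP[v -> vf] /fP[w -> wf] fCD; apply: wo_iso_class.
by apply: order_iso_trans vf _; rewrite fCD; apply: order_iso_sym wf; exact: 0.
Qed.

(** The point [u'] has [f u'] strictly below it. At the least such point [m], applying [f] puts
    [f (f m)] strictly below [f m], against minimality. *)
Lemma segment_not_iso (T : eqType) (R : rel T) (u u' : T) :
  well_order R -> u' \in before R u -> ~ order_iso (before R u) R (before R u') R.
Proof.
move=> Rwo u'u [f [[fu' finj _] fR]].
have [m [mu mf] lbm] := well_order_min Rwo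
  (P := [set x | x \in before R u /\ f x \in before R x])
  (conj u'u (fu' u' u'u)).
have fmu : f m \in before R u.
  by apply: (le_before_trans Rwo) mu; apply: (before_le Rwo).
suff /lbm : f m \in before R u /\ f (f m) \in before R (f m).
  by move=> Rmf; move: mf; rewrite inE Rmf.
by split=> //; rewrite inE -fR//.
Qed.

(** An injection copies each countable segment into [nat] as a [wo_nat]. Points with isomorphic
    copies have isomorphic segments, so they coincide by [segment_not_iso]. *)
Lemma countable_before_le_omega1 (T : eqType) (R : rel T) :
  well_order R -> countable_before R #<= omega1.
Proof.
move=> Rwo.
have /choice[c cP] : forall u, exists c : T -> nat, countable_before R u ->
    {in before R u &, injective c}.
  move=> u; have [/countable_injP[c cinj]|nu] := pselect (countable_before R u).
    by exists c => _ x y xu yu; apply: cinj; rewrite inE.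
  by exists (fun=> 0).
have /choice[W WP] : forall u, exists v : wo_nat, countable_before R u ->
    order_iso (before R u) R (wo_dom v) (wo_le v).
  move=> u; have [/cP cinj|nu] := pselect (countable_before R u); last first.
    have W0 : wo_chain (fun _ _ => true) (pred_of_simpl (@pred0 nat)).
      by move=> A sA [n /sA].
    by exists (WoNat W0) => /nu.
  pose D : {pred nat} := fun n => `[< exists2 x, x \in before R u & c u x = n >].
  pose L : rel nat := fun n m => `[< exists x y, [/\ x \in before R u,
    y \in before R u, c u x = n, c u y = m & R x y] >].
  have LE : {in before R u &, forall x y, R x y = L (c u x) (c u y)}.
    move=> x y xu yu; apply/idP/asboolP => [xy|]; first by exists x, y.
    by move=> [x' [y' [x'u y'u /cinj<-// /cinj<-//]]].
  have Dc x : x \in before R u -> c u x \in D.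
    by move=> xu; apply/asboolP; exists x.
  have Dwo : wo_chain L D.
    move=> A sAD [n nA]; have /asboolP[x xu xn] := sAD n nA.
    have [|m [mu mA] lbm] := well_order_min Rwo
      (P := [set x | x \in before R u /\ c u x \in A]) (x := x).
      by rewrite /= xn.
    exists (c u m); split=> [|k [kA lbk]].
      split=> // k kA; have /asboolP[y yu yk] := sAD k kA.
      by rewrite -yk -LE //; apply: lbm; rewrite /= yk.
    have /asboolP[y yu yk] := sAD k kA; rewrite -yk; congr (c u _).
    apply: (well_order_anti Rwo); first by apply: lbm; rewrite /= yk.
    by rewrite LE // yk; apply: lbk.
  exists (WoNat Dwo) => _; exists (c u); split=> //.
  split=> [x /Dc//|x y|n /asboolP[x xu xn]]; last by exists x.
  by rewrite !inE; apply: cinj.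
apply: (@card_le_inj _ _ _ _ (fun u => [set w | wo_iso (W u) w])).
  by move=> u _; exists (W u).
move=> u u'; rewrite !inE => /WP uW /WP uW' WW.
have {WW} WW : wo_iso (W u) (W u').
  suff : [set w | wo_iso (W u) w] (W u') by [].
  by rewrite WW; exists id; split=> //; split=> // x; exists x.
have u_u' : order_iso (before R u) R (before R u') R.
  apply: order_iso_trans uW (order_iso_trans WW _).
  exact: order_iso_sym uW'.
apply: contrapT => nuu'.
have [uu'|u'u] := boolP (R u u'); last exact: (segment_not_iso Rwo u'u u_u').
apply: (segment_not_iso Rwo _ (order_iso_sym u u_u')).
by rewrite inE; apply/negP => u'u; apply/nuu'/(well_order_anti Rwo).
Qed.

Lemma uncountable_cantor : ~ countable [set: nat -> bool].
Proof.
move=> /countable_injP[c cinj].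
have cinjT : injective c by move=> f g; apply: cinj; rewrite inE.
pose d n := ~~ `[< exists2 f, c f = n & f n >].
have : d (c d) = ~~ d (c d).
  rewrite {1}/d; congr (~~ _).
  by apply/asboolP/idP => [[f /cinjT->]//|dd]; exists d.
by case: (d (c d)).
Qed.

Lemma omega1_le_cantor : omega1 #<= [set: nat -> bool].
Proof.
have [R Rwo] := well_ordering_principle (nat -> bool).
apply: card_le_trans (omega1_le_countable_before Rwo uncountable_cantor) _.
exact: card_leT.
Qed.

Lemma nat_le_omega1 : [set: nat] #<= omega1.
Proof.
have leq_wo : well_order leq.
  apply: antisymmetric_well_order => [|A A0]; first exact: anti_leq.
  by exists (ex_minn A0); split; case: ex_minnP => // m _ lbm x /lbm.
apply: card_le_trans (countable_before_le_omega1 leq_wo).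
by apply: subset_card_le => n _; apply: countableP.
Qed.

Lemma lexicographic_well_order (T : eqType) (R : rel T) : well_order R ->
  well_order (fun x y : T * bool =>
    if x.1 == y.1 then x.2 ==> y.2 else R x.1 y.1).
Proof.
move=> Rwo; apply: antisymmetric_well_order => [[x b] [y c]|A [[x b] xA]] /=.
  rewrite [y == x]eq_sym; have [-> /andP[]|nxy /andP[Rxy Ryx]] := eqVneq x y.
    by case: b; case: c.
  by rewrite (well_order_anti Rwo Rxy Ryx) eqxx in nxy.
have [m [b' mA] lbm] := well_order_min Rwo
  (P := [set x | exists b, (x, b) \in A]) (ex_intro _ b xA).
exists (m, (m, false) \notin A); split.
  by case: (boolP ((m, false) \in A)) => //= mA'; case: b' mA mA' => [//|->].
move=> [y c] yA /=; case: eqVneq yA => [<-|_ yA]; last by apply: lbm; exists c.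
by case: c => [|->]//; rewrite implybT.
Qed.

(** [omega1] embeds in the points with countable segment of a well-order; doubling every point
    lexicographically keeps these segments countable. *)
Lemma omega1X_bool : omega1 `*` [set: bool] #<= omega1.
Proof.
have [R Rwo] := well_ordering_principle (nat -> bool).
have [f fR finj] := card_le_injfun (fun=> true)
  (omega1_le_countable_before Rwo uncountable_cantor).
apply: card_le_trans (countable_before_le_omega1 (lexicographic_well_order Rwo)).
apply: (@card_le_inj _ _ _ _ (fun x => (f x.1, x.2))) => [[C b] [/= /fR fC _]|].
  rewrite /countable_before /=.
  apply: (@sub_countable _ _ _ ((f C |` [set` before R (f C)]) `*` [set: bool])).
    apply: subset_card_le => -[x c] /=; rewrite inE /=; case: eqVneq => [->|_ xC].
      by split=> //; left.
    by split=> //; right; rewrite /= inE.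
  apply: countableX; last exact: countableP.
  by apply: countable_setU => //; apply: countable1.
move=> [C b] [D c]; rewrite !inE => -[/= C1 _] [/= D1 _] [fCD ->].
by congr pair; apply: finj; rewrite ?inE.
Qed.

(** * Coalgebras *)

Lemma prod_bool_le_omega1 (X : set_le_aleph1) : [set: X * bool] #<= omega1.
Proof.
apply: card_le_trans omega1X_bool.
have [f fo finj] := card_le_injfun set0 (underlying_le X).
apply: (@card_le_inj _ _ _ _ (fun x => (f x.1, x.2))) => [x _|].
  by split=> //=; apply: fo.
by move=> [x b] [y c] _ _ /= [/finj fxy ->]; rewrite fxy ?inE.
Qed.

Definition stream_map (X Y : set_le_aleph1) (f : X -> Y) (x : X * bool) :=
  (f x.1, x.2).

Lemma stream_map1 (X : set_le_aleph1) : @stream_map X X id = id.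
Proof. by apply/funext => -[]. Qed.

Definition stream_functor : endofunctor Set_le_aleph1 :=
  @Endofunctor Set_le_aleph1 (fun X => SetLeAleph1 (prod_bool_le_omega1 X))
    stream_map stream_map1 (fun _ _ _ _ _ => erefl).

Lemma cocomplete_continuum_hypothesis :
  algebraically_cocomplete Set_le_aleph1 -> continuum_hypothesis.
Proof.
move=> /(_ stream_functor)[T Tterm].
pose N := SetLeAleph1 nat_le_omega1.
pose stream (u : nat -> bool) : coalgebra stream_functor :=
  @Coalgebra Set_le_aleph1 stream_functor N (fun n => (n.+1, u n)).
have /choice[h hP] : forall u, exists h : nat -> carrier T,
    forall n, structure T (h n) = (h n.+1, u n).
  move=> u; have [[h hP] _] := Tterm (stream u); exists h => n.
  exact: (congr1 (@^~ n) hP).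
(* The states along [u] are iterates of the transition of [T] from [h u 0], so this one state
   determines the whole of [u]. *)
have hE u n : h u n = iter n (fun t => (structure T t).1) (h u 0).
  by elim: n => //= n <-; rewrite hP.
apply: Cantor_Bernstein omega1_le_cantor.
apply: card_le_trans (underlying_le (carrier T)).
apply: (@card_le_inj _ _ _ _ (h^~ 0)) => // u v _ _ huv.
by apply/funext => n; have := hP u n; rewrite hE huv -hE hP => -[].
Qed.

(** This serves as the quotient by the equivalence that [R] generates, given by representatives. The
    class of [w] consists of the points that no map respecting [R] separates from [w], so no closure
    has to be built. *)
Lemma quotient_section (W : Type) (R : W -> W -> Prop) :
  exists2 canon : W -> W, forall w w', R w w' -> canon w = canon w' &
    forall (Z : Type) (f : W -> Z), (forall w w', R w w' -> f w = f w') ->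
      forall w, f (canon w) = f w.
Proof.
have [[w0]|W0] := pselect (inhabited W); last first.
  by exists id => // w; case: W0; exists.
pose respects Z (f : W -> Z) := forall w w', R w w' -> f w = f w'.
pose class w := [set w' | forall Z (f : W -> Z), respects Z f -> f w' = f w].
have /choice[ch chP] : forall C : set W, exists x, (exists w, C w) -> C x.
  move=> C; have [[w Cw]|nC] := pselect (exists w, C w); first by exists w.
  by exists w0 => /nC.
exists (fun w => ch (class w)) => [w w' ww'|Z f fR w].
  congr ch; apply/funext => v; apply/propext.
  by split=> vw Z f fR; rewrite vw // (fR w w').
by have /(_ _ f fR) : class w (ch (class w)) by apply: chP; exists w.
Qed.

(** * Countable supports under the continuum hypothesis *)

Section Cocompleteness.
Hypothesis CH : continuum_hypothesis.

Let Omega := nat -> bool.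

Lemma injective_cantor_le_omega1 (T : Type) (f : T -> Omega) :
  injective f -> [set: T] #<= omega1.
Proof.
move=> finj; have /card_eqPle[le_omega1 _] := CH.
apply: card_le_trans le_omega1.
by apply: (@card_le_inj _ _ _ _ f) => // x y _ _; apply: finj.
Qed.

Lemma object_le_cantor (X : set_le_aleph1) : exists f : X -> Omega, injective f.
Proof.
have [f _ finj] := card_le_injfun (fun=> true)
  (card_le_trans (underlying_le X) omega1_le_cantor).
by exists f => x y; apply: finj; rewrite inE.
Qed.

Lemma powerset_countType_le_omega1 (I : countType) :
  [set: I -> bool] #<= omega1.
Proof.
apply: (@injective_cantor_le_omega1 (I -> bool) (fun f n => oapp f false (unpickle n))).
move=> f g fg; apply/funext => i.
by have := congr1 (@^~ (pickle i)) fg; rewrite /= pickleK.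
Qed.

Lemma countType_le_omega1 (I : countType) : [set: I] #<= omega1.
Proof.
apply: card_le_trans nat_le_omega1.
exact: countableP.
Qed.

Lemma cantor_square_le_omega1 : [set: Omega * Omega] #<= omega1.
Proof.
apply: card_le_trans (powerset_countType_le_omega1 (nat + nat)%type).
apply: (@card_le_inj _ _ _ _ (fun x i =>
  match i with inl n => x.1 n | inr n => x.2 n end)) => //.
move=> [f g] [f' g'] _ _ fg; congr pair; apply/funext => n.
  exact: (congr1 (@^~ (inl n)) fg).
exact: (congr1 (@^~ (inr n)) fg).
Qed.

(** By the continuum hypothesis [Omega] injects into the points with countable segment of a
    well-order, and [S x y] compares the images of [x] and [y] there. *)
Lemma sierpinski_relation : exists S : Omega -> Omega -> Prop,
  (forall y, countable [set x | S x y]) /\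
  (forall x, countable [set y | ~ S x y]).
Proof.
have [R Rwo] := well_ordering_principle Omega.
have [f fR finj] : exists2 f : Omega -> Omega,
    set_fun setT (countable_before R) f & set_inj setT f.
  apply: (card_le_injfun (fun=> true : bool)).
  have /card_eqPle[le_omega1 _] := CH.
  apply: card_le_trans le_omega1 _.
  exact: omega1_le_countable_before Rwo uncountable_cantor.
have preim_countable (A : set Omega) : countable A -> countable (f @^-1` A).
  apply: sub_countable; apply: (@card_le_inj _ _ _ _ f) => // x y _ _.
  by apply: finj; rewrite inE.
exists (fun x y => R (f x) (f y)); split=> y; last first.
  apply: sub_countable (preim_countable _ (fR y I)).
  by apply: subset_card_le => x /negP.
apply: sub_countable (preim_countable (f y |` [set` before R (f y)]) _).
  apply: subset_card_le => x /= xy.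
  have [->|nxy] := pselect (f x = f y); first by left.
  right; rewrite /= inE; apply/negP => yx; exact/nxy/(well_order_anti Rwo).
by apply: countable_setU; [exact: countable1 | exact: fR].
Qed.

Lemma countable_image_inj (T U V : Type) (A : set T) (j : T -> U) (B : set U)
    (g : T -> V) :
  injective j -> set_fun A B j -> countable B -> countable (g @` A).
Proof.
move=> jinj AB; apply: sub_countable; apply: card_le_trans (card_image_le _ _) _.
by apply: (@card_le_inj _ _ _ _ j) => // x y _ _ /jinj.
Qed.

Section Functor.
Variable F : endofunctor Set_le_aleph1.

Let N := SetLeAleph1 (countType_le_omega1 nat).
Let L := SetLeAleph1 (countType_le_omega1 (seq nat)).
Let O := SetLeAleph1 (powerset_countType_le_omega1 nat).
Let O2 := SetLeAleph1 cantor_square_le_omega1.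

Lemma fmap_comp (A B D : set_le_aleph1) (g : B -> D) (f : A -> B) (x : F A) :
  @fmap _ F B D g (@fmap _ F A B f x) = @fmap _ F A D (g \o f) x.
Proof. by rewrite (congr1 (@^~ x) (@fmapM _ F A B D g f)). Qed.

Lemma fmap_idE (A : set_le_aleph1) (x : F A) : @fmap _ F A A id x = x.
Proof. exact: (congr1 (@^~ x) (@fmap1 _ F A)). Qed.

(* The graphs of g and G v agree only on a countable set and send x to the same
   element; projecting back along g shows that x is fixed by a map that is the
   identity on that set and constant elsewhere. *)
Lemma fmap_countable_range (x : F O) : exists e : Omega -> Omega,
  countable (range e) /\ @fmap _ F O O e x = x.
Proof.
have [S [S_down S_up]] := sierpinski_relation.
have [j jinj] := object_le_cantor (F O2).
pose graph (g : Omega -> Omega) : O -> O2 := fun a => (a, g a).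
(* [G v] is one function whose graph sends [x] to [v], if there is any. These functions are indexed
   by [F O2], which [j] embeds in [Omega]. *)
have /choice[G GP] : forall v : F O2, exists g : Omega -> Omega,
    (exists h, @fmap _ F O O2 (graph h) x = v) ->
    @fmap _ F O O2 (graph g) x = v.
  move=> v; have [[h hv]|nv] := pselect (exists h, @fmap _ F O O2 (graph h) x = v).
    by exists h.
  by exists id.
(* At [a] the countably many values [G v a] with [S (j v) a] are avoided, so [g] meets [G v] only
   where [S (j v)] fails, on a countable set. *)
have /choice[g gP] : forall a : Omega, exists b : Omega,
    ~ ((fun v => G v a) @` [set v | S (j v) a]) b.
  move=> a; apply: countable_uncountableP uncountable_cantor _.
  exact: (countable_image_inj _ jinj _ (S_down a)).
pose v := @fmap _ F O O2 (graph g) x.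
have Gv : @fmap _ F O O2 (graph (G v)) x = v by apply: GP; exists g.
pose p : Omega := fun=> true.
pose k : O2 -> O := fun ab => if `[< ab.2 = g ab.1 >] then ab.1 else p.
exists (k \o graph (G v)); split; last first.
  rewrite -(@fmap_comp O O2 O) Gv fmap_comp -[RHS]fmap_idE; congr (fmap F _ x).
  by apply/funext => a; rewrite /k /=; case: asboolP.
apply: sub_countable (countable_setU (countable1 p) (S_up (j v))).
apply: subset_card_le => _ [a _ <-]; rewrite /= /k /=.
case: asboolP => [Gva|_]; last by left.
by right=> Sva; apply: (gP a); exists v.
Qed.

(** Embed [A] in [Omega] by [i], with retraction [r]. If [e] has countable range and fixes the image
    of [x], then [r \o e \o i] fixes [x] and factors through [nat] by a numbering of that range. The
    point [a] serves as default value. *)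
Lemma countable_support (A : set_le_aleph1) (a : A) (x : F A) :
  exists (s : N -> A) (y : F N), @fmap _ F N A s y = x.
Proof.
have [i iinj] := object_le_cantor A.
have /choice[r rP] : forall b : Omega, exists c : A, forall d, i d = b -> c = d.
  move=> b; have [[d <-]|nb] := pselect (exists d, i d = b).
    by exists d => e /iinj.
  by exists a => d db; case: nb; exists d.
have [e [e_countable ex]] := fmap_countable_range (@fmap _ F A O i x).
have /countable_injP[c cinj] := e_countable.
have /choice[s sP] : forall n : nat, exists b : A,
    forall d, range e d -> c d = n -> b = r d.
  move=> n; have [[d [de <-]]|nn] := pselect (exists d, range e d /\ c d = n).
    by exists (r d) => d' d'e /cinj ->//; rewrite inE.
  by exists a => d de dn; case: nn; exists d.
exists s, (@fmap _ F A N (fun b => c (e (i b))) x).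
rewrite fmap_comp.
transitivity (@fmap _ F A A (r \o (e \o i)) x).
  by congr (fmap F _ x); apply/funext => b; apply: sP => //; exists (i b).
rewrite -[LHS](@fmap_comp A O A r (e \o i)).
rewrite -[X in fmap F _ X](@fmap_comp A O O e i) ex fmap_comp -[RHS]fmap_idE.
by congr (fmap F _ x); apply/funext => b; apply: rP.
Qed.

(** * Coalgebras on finite sequences and the terminal coalgebra *)

Definition sequence_hom (A : coalgebra F) (sigma : L -> F L)
    (s : L -> carrier A) :=
  forall l, structure A (s l) = @fmap _ F L (carrier A) s (sigma l).

(* s (n :: l) is the n-th point of a countable support of structure A (s l). *)
Lemma sequence_hom_through (A : coalgebra F) (a : carrier A) :
  exists sigma s, sequence_hom sigma s /\ s [::] = a.
Proof.
have /choice[t tP] : forall b : carrier A, exists ty : (N -> carrier A) * F N,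
    @fmap _ F N (carrier A) ty.1 ty.2 = structure A b.
  move=> b; have [s [y sy]] := countable_support b (structure A b).
  by exists (s, y).
pose s : L -> carrier A := foldr (fun n b => (t b).1 n) a.
exists (fun l => @fmap _ F N L (cons^~ l) (t (s l)).2), s; split=> // l.
by rewrite fmap_comp -tP.
Qed.

(** The disjoint sum of all coalgebras carried by [L]: a structure together with a position in
    it. *)
Let W := ((L -> F L) * seq nat)%type.

(** A pair is coded by bits on a countable type: the code of [sigma l] for every [l], and the
    indicator of the position. *)
Lemma sequence_coalgebras_le_omega1 : [set: W] #<= omega1.
Proof.
have [j jinj] := object_le_cantor (F L).
apply: card_le_trans (powerset_countType_le_omega1 (seq nat * nat + seq nat)%type).
apply: (@card_le_inj _ _ _ _ (fun w i =>
  match i with inl (l, n) => j (w.1 l) n | inr l => l == w.2 end)) => //.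
move=> [sigma l] [sigma' l'] _ _ E; congr pair.
  apply/funext => k; apply: jinj; apply/funext => n.
  exact: (congr1 (@^~ (inl (k, n))) E).
have := congr1 (@^~ (inr l)) E; rewrite /= eqxx => /esym/eqP//.
Qed.

(** Such points have equal images in any terminal coalgebra, since the unique homomorphisms into it
    factor through [A]. *)
Definition share_image (w w' : W) :=
  exists (A : coalgebra F) (s s' : L -> carrier A),
    [/\ sequence_hom w.1 s, sequence_hom w'.1 s' & s w.2 = s' w'.2].

Lemma terminal_coalgebra : exists T : coalg_category F, terminal_object T.
Proof.
have [canon meet_canon canonE] := quotient_section share_image.
have canonK w : canon (canon w) = canon w by apply: canonE.
pose T := {w | canon w = w}.
pose q w : T := exist _ (canon w) (canonK w).
have valq (t : T) : q (sval t) = t.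
  by case: t => w wE; apply: eq_exist.
have T_le : [set: T] #<= omega1.
  apply: card_le_trans sequence_coalgebras_le_omega1.
  apply: (@card_le_inj _ _ _ _ (@sval _ _)) => // t t' _ _ tt'.
  by rewrite -[t]valq tt' valq.
have q_meet w w' : share_image w w' -> q w = q w'.
  by move=> /meet_canon ww'; apply: eq_exist.
pose TO := SetLeAleph1 T_le.
(* [h] sends [a] to the class of any point mapped onto it; [A] itself witnesses that all such points
   share one class. *)
have behaviour (A : coalgebra F) : exists h : carrier A -> TO,
    forall sigma (s : L -> carrier A), sequence_hom sigma s ->
    forall l, h (s l) = q (sigma, l).
  have /choice[g gP] : forall a : carrier A, exists w : W,
      exists2 s : L -> carrier A, sequence_hom w.1 s & s w.2 = a.
    move=> a; have [sigma [s [sP sa]]] := sequence_hom_through a.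
    by exists (sigma, [::]), s.
  exists (fun a => q (g a)) => sigma s sP l; apply: q_meet.
  by have [s' s'P s'E] := gP (s l); exists A, s', s.
pose step (w : W) : F TO := @fmap _ F L TO (fun l => q (w.1, l)) (w.1 w.2).
have step_behaviour (A : coalgebra F) (h : carrier A -> TO) :
    (forall sigma (s : L -> carrier A), sequence_hom sigma s ->
      forall l, h (s l) = q (sigma, l)) ->
    forall sigma (s : L -> carrier A), sequence_hom sigma s ->
    forall l, step (sigma, l) = @fmap _ F (carrier A) TO h (structure A (s l)).
  move=> hP sigma s sP l; rewrite sP fmap_comp /step.
  by congr (fmap F _ _); apply/funext => k; rewrite /= (hP sigma).
(* Both sides are the image under [fmap F h] of the structure at the common point, so [step]
   descends to classes. *)
have step_meet w w' : share_image w w' -> step w = step w'.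
  case: w w' => sigma l [sigma' l'] [A [s [s' [/= sP s'P ss']]]].
  have [h hP] := behaviour A.
  by rewrite (step_behaviour A h hP _ _ sP) ss' -(step_behaviour A h hP _ _ s'P).
pose tau (t : TO) : F TO := step (sval t).
have tau_q w : tau (q w) = step w by apply: canonE.
exists (@Coalgebra Set_le_aleph1 F TO tau) => A.
have [h hP] := behaviour A.
have h_hom : @compc Set_le_aleph1 _ _ _ tau h =
    @compc Set_le_aleph1 _ _ _ (@fmap _ F (carrier A) TO h) (structure A).
  apply/funext => a /=; have [sigma [s [sP <-]]] := sequence_hom_through a.
  by rewrite (hP sigma) // tau_q (step_behaviour A h hP _ _ sP).
exists (exist _ h h_hom) => k; apply: coalg_hom_inj => /=.
apply/funext => a; have [sigma [s [sP <-]]] := sequence_hom_through a.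
rewrite (hP sigma) // -[LHS]valq; apply: q_meet.
case: k => k kP /=; set t := k (s [::]).
(* Uniqueness: the quotient is itself the common coalgebra. The representative of [t] reaches [t]
   through the quotient map, and [(sigma, [::])] reaches it through [k \o s]. *)
exists (@Coalgebra Set_le_aleph1 F TO tau), (fun l => q ((sval t).1, l)), (k \o s).
split=> [l|l|/=]; first exact: tau_q.
  by rewrite -fmap_comp -sP; exact: (congr1 (@^~ (s l)) kP).
by rewrite -surjective_pairing valq.
Qed.

End Functor.

End Cocompleteness.

Theorem corollary2p17 :
  algebraically_cocomplete Set_le_aleph1 <-> continuum_hypothesis.
Proof.
split; first exact: cocomplete_continuum_hypothesis.
by move=> CH F; apply: terminal_coalgebra.
Qed.
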